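(* Let $\mathbb{G}$ be a finite quantum group and let $\nu\in M_p(\mathbb{G})$. The random walk on $\mathbb{G}$ given by $\nu$ is irreducible if and only if $\nu$ is not supported on a proper quasi-subgroup.
   Context: A finite quantum group $\mathbb{G}$ is given by its algebra of functions $F(\mathbb{G})$: a finite-dimensional unital $\mathrm{C}^*$-algebra with a $*$-homomorphism (comultiplication) $\Delta:F(\mathbb{G})\to F(\mathbb{G})\otimes F(\mathbb{G})$, a counit $\varepsilon$ and an antipode $S$ making $(F(\mathbb{G}),\Delta,S,\varepsilon)$ a Hopf $*$-algebra. Its unit is $\mathds{1}_{\mathbb{G}}$. $2^{\mathbb{G}}$ denotes the set of projections ($p=p^*=p^2$) in $F(\mathbb{G})$, and $M_p(\mathbb{G})$ the set of states (positive linear functionals $\mu$ with $\mu(\mathds{1}_{\mathbb{G}})=1$) on $F(\mathbb{G})$. A random walk on $\mathbb{G}$ is given by a state $\nu\in M_p(\mathbb{G})$; its convolution powers are $\nu^{\star 1}=\nu$, $\nu^{\star(k+1)}=(\nu\otimes\nu^{\star k})\circ\Delta$. The random walk given by $\nu$ is reducible if there exists a non-zero $q\in2^{\mathbb{G}}$ such that $\nu^{\star k}(q)=0$ for all integers $k\ge1$; otherwise it is irreducible. A group-like projection is a non-zero $p\in 2^{\mathbb{G}}$ with $\Delta(p)(\mathds{1}_{\mathbb{G}}\otimes p)=p\otimes p$. To a group-like projection one associates a (virtual) quasi-subgroup $\mathbb{S}\subseteq\mathbb{G}$ and writes the projection as $\mathds{1}_{\mathbb{S}}$; $\mathbb{S}$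 is proper if $\mathds{1}_{\mathbb{S}}\neq\mathds{1}_{\mathbb{G}}$. A state $\nu$ is supported on a quasi-subgroup $\mathbb{S}$ if $\nu(\mathds{1}_{\mathbb{S}})=1$. *)

(* Defs.v *)
From HB Require Import structures.
From mathcomp Require Import all_boot all_order all_algebra.
From mathcomp Require Import falgebra reals complex.

Set Implicit Arguments.
Unset Strict Implicit.
Unset Printing Implicit Defensive.

Import Order.TTheory GRing.Theory Num.Theory.
Import VectorInternalTheory.
Local Open Scope ring_scope.

(* The tensor product of finite-dimensional spaces is modelled by matrices of
   coordinates with respect to the coordinate bases [tbasis U] and [tbasis V]
   that come with the vectType structures; [tlift_tens] and [tlift_uniq] are
   its universal property. *)
Section TensorProduct.
Context {K : fieldType}.

Definition tensor (U V : vectType K) : Type := 'M[K]_(dim U, dim V).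

HB.instance Definition _ (U V : vectType K) :=
  Vector.copy (tensor U V) 'M[K]_(dim U, dim V).

Definition tbasis (U : vectType K) (i : 'I_(dim U)) : U := r2v (delta_mx 0 i).

Definition tens (U V : vectType K) (u : U) (v : V) : tensor U V :=
  (v2r u)^T *m v2r v.

Definition tlift (U V : vectType K) (W : lmodType K) (B : U -> V -> W)
    (t : tensor U V) : W :=
  \sum_i \sum_j t i j *: B (tbasis i) (tbasis j).

Lemma tlift_is_linear (U V : vectType K) (W : lmodType K) (B : U -> V -> W) :
  linear (tlift B).
Proof.
move=> a s t; rewrite /tlift scaler_sumr -big_split; apply: eq_bigr => i _.
rewrite scaler_sumr -big_split; apply: eq_bigr => j _ /=.
by rewrite !mxE scalerDl scalerA.
Qed.

HB.instance Definition _ (U V : vectType K) (W : lmodType K)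
    (B : U -> V -> W) :=
  GRing.isLinear.Build K (tensor U V) W _ (tlift B) (tlift_is_linear B).

Lemma tbasis_sum (U : vectType K) (u : U) :
  u = \sum_i v2r u 0 i *: tbasis i.
Proof.
rewrite -{1}[u]v2rK {1}[v2r u]row_sum_delta linear_sum /=.
by apply: eq_bigr => i _; rewrite linearZ.
Qed.

Lemma tensDl (U V : vectType K) (v : V) : linear ((@tens U V)^~ v).
Proof.
by move=> a x y; rewrite /tens linearP /= linearP /= mulmxDl -scalemxAl.
Qed.

Lemma tensDr (U V : vectType K) (u : U) : linear (@tens U V u).
Proof. by move=> a x y; rewrite /tens linearP /= mulmxDr -scalemxAr. Qed.

Lemma linear_sumZ (U W : lmodType K) (f : U -> W) (hf : linear f)
    n (c : 'I_n -> K) (x : 'I_n -> U) :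
  f (\sum_i c i *: x i) = \sum_i c i *: f (x i).
Proof.
pose g : {linear U -> W} := HB.pack f (GRing.isLinear.Build K U W _ f hf).
rewrite -[LHS]/(g _) linear_sum; apply: eq_bigr => i _.
by rewrite linearZ.
Qed.

Lemma tlift_tens (U V : vectType K) (W : lmodType K) (B : U -> V -> W)
    (hl : forall v, linear (B^~ v)) (hr : forall u, linear (B u))
    (u : U) (v : V) :
  tlift B (tens u v) = B u v.
Proof.
rewrite [u in RHS]tbasis_sum (linear_sumZ (hl v)); apply: eq_bigr => i _.
rewrite [v in RHS]tbasis_sum (linear_sumZ (hr _)) scaler_sumr.
by apply: eq_bigr => j _; rewrite scalerA mxE big_ord1 mxE.
Qed.

Lemma tensE (U V : vectType K) (t : tensor U V) :
  t = \sum_i \sum_j t i j *: tens (tbasis i) (tbasis j).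
Proof.
rewrite {1}[t](matrix_sum_delta (t : 'M_(_, _))); apply: eq_bigr => i _.
apply: eq_bigr => j _; congr (_ *: _); rewrite /tens /tbasis !r2vK.
by rewrite trmx_delta mul_delta_mx.
Qed.

Lemma tlift_uniq (U V : vectType K) (W : lmodType K) (f g : tensor U V -> W)
    (hf : linear f) (hg : linear g) :
  (forall u v, f (tens u v) = g (tens u v)) -> f =1 g.
Proof.
move=> fg t.
pose f' : {linear tensor U V -> W} :=
  HB.pack f (GRing.isLinear.Build K (tensor U V) W _ f hf).
pose g' : {linear tensor U V -> W} :=
  HB.pack g (GRing.isLinear.Build K (tensor U V) W _ g hg).
rewrite -[LHS]/(f' t) -[RHS]/(g' t) [t]tensE !linear_sum; apply: eq_bigr => i _.
rewrite !linear_sum; apply: eq_bigr => j _; rewrite !linearZ; congr (_ *: _).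
exact: fg.
Qed.

Definition tmap (U V U' V' : vectType K) (f : U -> U') (g : V -> V')
    (t : tensor U V) : tensor U' V' :=
  tlift (fun u v => tens (f u) (g v)) t.

Definition tassoc (U V W : vectType K) (t : tensor (tensor U V) W) :
    tensor U (tensor V W) :=
  tlift (fun s w => tlift (fun u v => tens u (tens v w)) s) t.

End TensorProduct.

Section TensorAlgebra.
Context {K : fieldType}.
Variables A B : falgType K.
Implicit Types (a : A) (b : B) (s t : tensor A B).

Definition tone : tensor A B := tens 1 1.

Definition tmul s t : tensor A B :=
  tlift (fun a b => tlift (fun a' b' => tens (a * a') (b * b')) t) s.

Lemma tlift_linear_in (U V : vectType K) (X W : lmodType K)
    (F : X -> U -> V -> W) (hF : forall u v, linear (fun x => F x u v))
    (t : tensor U V) :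
  linear (fun x => tlift (F x) t).
Proof.
move=> c x y; rewrite /tlift scaler_sumr -big_split.
apply: eq_bigr => i _; rewrite scaler_sumr -big_split; apply: eq_bigr => j _ /=.
by rewrite hF scalerDr !scalerA mulrC.
Qed.

Lemma tmul_linear_r s : linear (tmul s).
Proof.
apply: tlift_linear_in => a b; exact: tlift_is_linear.
Qed.

Lemma tmul_linear_l t : linear (tmul^~ t).
Proof. exact: tlift_is_linear. Qed.

Lemma tmul_tens a b a' b' :
  tmul (tens a b) (tens a' b') = tens (a * a') (b * b').
Proof.
rewrite /tmul tlift_tens.
- rewrite tlift_tens // => x c y z; rewrite mulrDr -scalerAr.
  + by rewrite tensDl.
  + by rewrite tensDr.
- move=> x; apply: tlift_linear_in => u v c y z.
  by rewrite mulrDl -scalerAl tensDl.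
- move=> x; apply: tlift_linear_in => u v c y z.
  by rewrite mulrDl -scalerAl tensDr.
Qed.

Lemma tmulA : associative tmul.
Proof.
move=> s t r; move: s; apply: tlift_uniq.
- exact: tmul_linear_l.
- by move=> c x y; rewrite !tmul_linear_l.
move=> a b; move: t; apply: tlift_uniq.
- by move=> c x y; rewrite tmul_linear_l tmul_linear_r.
- by move=> c x y; rewrite tmul_linear_r tmul_linear_l.
move=> a' b'; move: r; apply: tlift_uniq.
- by move=> c x y; rewrite !tmul_linear_r.
- by move=> c x y; rewrite !tmul_linear_r.
by move=> a'' b''; rewrite !tmul_tens !mulrA.
Qed.

Lemma tmul1t : left_id tone tmul.
Proof.
apply: tlift_uniq; [exact: tmul_linear_r | by move=> ? ? ? |].
by move=> a b; rewrite tmul_tens !mul1r.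
Qed.

Lemma tmult1 : right_id tone tmul.
Proof.
apply: (tlift_uniq (f := tmul^~ tone)); [exact: tmul_linear_l | by [] |].
by move=> a b; rewrite tmul_tens !mulr1.
Qed.

Lemma tmulDl : left_distributive tmul +%R.
Proof. by move=> x y t; have := tmul_linear_l t 1 x y; rewrite !scale1r. Qed.

Lemma tmulDr : right_distributive tmul +%R.
Proof. by move=> t x y; have := tmul_linear_r t 1 x y; rewrite !scale1r. Qed.

Lemma tone_neq0 : tone != 0.
Proof.
have n0 (C : falgType K) : exists i, v2r (1 : C) 0 i != 0.
  apply/rV0Pn; rewrite -(linear0 (@v2r _ C)) (inj_eq (@v2r_inj _ _)); exact: oner_neq0.
have [[i hi] [j hj]] := (n0 A, n0 B).
apply/eqP => /matrixP/(_ i j)/eqP.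
by rewrite mxE big_ord1 !mxE mulf_eq0 (negPf hi) (negPf hj).
Qed.

HB.instance Definition _ := GRing.Zmodule_isNzRing.Build (tensor A B)
  tmulA tmul1t tmult1 tmulDl tmulDr tone_neq0.

Lemma tensor_scaleAl (c : K) s t : c *: (s * t) = (c *: s) * t.
Proof.
by have := tmul_linear_l t c s 0; rewrite addr0 (mul0r t : tmul 0 t = 0) addr0.
Qed.

HB.instance Definition _ := GRing.Lmodule_isLalgebra.Build K (tensor A B)
  tensor_scaleAl.

Lemma tensor_scaleAr (c : K) s t : c *: (s * t) = s * (c *: t).
Proof.
by have := tmul_linear_r s c t 0; rewrite addr0 (mulr0 s : tmul s 0 = 0) addr0.
Qed.

HB.instance Definition _ := GRing.Lalgebra_isAlgebra.Build K (tensor A B)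
  tensor_scaleAr.

End TensorAlgebra.

(* Completeness of the norm is automatic in finite dimension. *)
HB.mixin Record isFinCStarAlgebra (R : realType) A of Falgebra R[i] A := {
  star : A -> A;
  star_conj_linear : forall (c : R[i]) (x y : A),
    star (c *: x + y) = c^* *: star x + star y;
  starM : forall x y : A, star (x * y) = star y * star x;
  starK : involutive star;
  cstar_norm : A -> R;
  cstar_norm_eq0 : forall x : A, cstar_norm x = 0 -> x = 0;
  cstar_normD : forall x y : A,
    cstar_norm (x + y) <= cstar_norm x + cstar_norm y;
  cstar_normZ : forall (c : R[i]) (x : A),
    cstar_norm (c *: x) = ComplexField.Normc.normc c * cstar_norm x;
  cstar_normM : forall x y : A,
    cstar_norm (x * y) <= cstar_norm x * cstar_norm y;
  cstar_norm_star : forall x : A,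
    cstar_norm (star x * x) = cstar_norm x ^+ 2
}.

#[short(type="finCStarAlgType")]
HB.structure Definition FinCStarAlgebra (R : realType) :=
  { A of isFinCStarAlgebra R A & Falgebra R[i] A }.

(* The conjugate-linear extension of a (x) b |-> a^* (x) b^*. *)
Definition tstar (R : realType) (A B : finCStarAlgType R) (t : tensor A B) :
    tensor A B :=
  \sum_i \sum_j (t i j)^* *: tens (star (tbasis i)) (star (tbasis j)).

Lemma tstar_tens (R : realType) (A B : finCStarAlgType R) (a : A) (b : B) :
  tstar (tens a b) = tens (star a) (star b).
Proof.
have starE (C : finCStarAlgType R) (x : C) :
    star x = \sum_i (v2r x 0 i)^* *: star (tbasis i).
  have starD (y z : C) : star (y + z) = star y + star z.
    by rewrite -[y in LHS]scale1r star_conj_linear conjC1 scale1r.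
  have star0 : star (0 : C) = 0.
    by apply: (addrI (star 0)); rewrite -starD !addr0.
  rewrite [x in LHS]tbasis_sum (big_morph (@star R C) starD star0).
  apply: eq_bigr => i _.
  by rewrite -[X in star X]addr0 star_conj_linear star0 addr0.
rewrite (starE A a) (linear_sumZ (tensDl _)) /tstar; apply: eq_bigr => i _.
rewrite (starE B b) (linear_sumZ (tensDr _)) scaler_sumr.
by apply: eq_bigr => j _; rewrite scalerA mxE big_ord1 mxE rmorphM.
Qed.

HB.mixin Record isFinQuantumGroup (R : realType) A of FinCStarAlgebra R A := {
  comult : {lrmorphism A -> tensor A A};
  counit : {lrmorphism A -> R[i] | *%R};
  antipode : {linear A -> A};
  comult_star : forall x : A, comult (star x) = tstar (comult x);
  comultA : forall x : A,
    tassoc (tmap comult idfun (comult x)) = tmap idfun comult (comult x);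
  counitl : forall x : A, tlift (fun a b : A => counit a *: b) (comult x) = x;
  counitr : forall x : A, tlift (fun a b : A => counit b *: a) (comult x) = x;
  antipodel : forall x : A,
    tlift (fun a b : A => antipode a * b) (comult x) = (counit x)%:A;
  antipoder : forall x : A,
    tlift (fun a b : A => a * antipode b) (comult x) = (counit x)%:A
}.

(* An object G is identified with its algebra of functions F(G). *)
#[short(type="finQuantumGroupType")]
HB.structure Definition FinQuantumGroup (R : realType) :=
  { A of isFinQuantumGroup R A & FinCStarAlgebra R A }.

Section RandomWalk.
Context {R : realType} {G : finQuantumGroupType R}.

Definition projection (p : G) : Prop := star p = p /\ p * p = p.

(* The order on [R[i]] makes [0 <= z] say that z is real and nonnegative; the
   positive elements of a C*-algebra are those of the form x^* x. *)
Definition state (nu : {scalar G}) : Prop :=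
  (forall x : G, 0 <= nu (star x * x)) /\ nu 1 = 1.

Definition conv (mu nu : G -> R[i]) (x : G) : R[i] :=
  tlift (fun a b : G => mu a * nu b : R[i]^o) (comult x).

(* Meaningful for k >= 1. *)
Definition conv_pow (nu : G -> R[i]) (k : nat) : G -> R[i] :=
  iter k.-1 (conv nu) nu.

Definition reducible (nu : {scalar G}) : Prop :=
  exists q : G, [/\ projection q, q <> 0 &
    forall k : nat, (1 <= k)%N -> conv_pow nu k q = 0].

Definition irreducible (nu : {scalar G}) : Prop := ~ reducible nu.

Definition group_like_projection (p : G) : Prop :=
  [/\ projection p, p <> 0 & comult p * tens 1 p = tens p p].

End RandomWalk.

Record quasi_subgroup (R : realType) (G : finQuantumGroupType R) :=
  QuasiSubgroup {
    indicator : G;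
    indicator_group_like : group_like_projection indicator
  }.

Definition proper_quasi_subgroup (R : realType) (G : finQuantumGroupType R)
    (S : quasi_subgroup G) : Prop :=
  indicator S <> 1.

Definition supported (R : realType) (G : finQuantumGroupType R)
    (nu : {scalar G}) (S : quasi_subgroup G) : Prop :=
  nu (indicator S) = 1.

(* Main.v *)
Require Import Defs.
From HB Require Import structures.
From mathcomp Require Import all_boot all_order all_algebra.
From mathcomp Require Import falgebra reals complex spectral sesquilinear ring.

Set Implicit Arguments.
Unset Strict Implicit.
Unset Printing Implicit Defensive.

Import Order.TTheory GRing.Theory Num.Theory.
Import VectorInternalTheory.
Local Open Scope ring_scope.
Local Open Scope sesquilinear_scope.

(** A state [nu] supported on a group-like projection [p] satisfies
[(id (x) nu) (comult p) = p], because [nu] does not distinguish [b * p] from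
[b]; by induction every convolution power of [nu] takes the value 1 at [p], so
if [p] is not 1 the projection [1 - p] witnesses reducibility.

Conversely, let [q] witness reducibility.  The Cesaro means of the convolution
powers of [nu] converge to a state [h] which is invariant under convolution by
[nu], hence idempotent, and which vanishes at [q].  Let [p] be the support
projection of [h], that is, the projection such that the left ideal of all [x]
with [h (x^* x) = 0] consists of the [x] with [x p = 0].  It differs from 1
because [q] lies in this ideal.  The core of the proof is [idempotent_support]:
the support of an idempotent state is group-like.  Write
[E x = (id (x) h) (comult x)] and [u = 1 - p].

- Idempotence of [h] puts [E u] in the null ideal of [h]; hence
  [E u = u (E u) u], and [w = u - E u = u (E p) u] is a compression of the
  image under the positive map [E] of a projection.
- [E w = 0], since [E] is idempotent.  The antipode shows that [x] is 0 once
  [(id (x) h (c .)) (comult x)] is 0 for all [c] ([act_separates]).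
  This makes the functional [tau o E] faithful for a faithful trace [tau], and
  positivity of [w] then forces [w = 0], that is, [E p = p].
- For [z = comult p - p (x) 1], the identity [E p = p] gives
  [(id (x) h) (z^* z) = 0], so [z] is killed on the right by [1 (x) p]; this
  is the group-like identity.

Finally [nu p = nu (E p) = (nu * h) p = h p = 1].

The analytic input is obtained by linear algebra.  The trace of the left
regular representation is a faithful positive functional
([regular_trace_faithful]); an orthonormal basis [e] for it satisfies
[sum_k e_k e_k^* = 1] ([casimir]), which bounds all states at once
([states_bounded]) and so makes the Cesaro argument work.  The limit itself is
written as a fixed linear combination of finitely many convolution powers
([mean_ergodic_combination]), so that invariance and vanishing at [q] are
algebraic, and only positivity needs the averages ([cesaro_ge0]). *)

(** * Matrices with real spectrum and positive semidefinite matrices *)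

(** In a triangular form of [M] the trace of [M^2] is the sum of the squares of
the eigenvalues; when it vanishes, the characteristic polynomial is a power of
['X]. *)
Lemma mxtrace_sqr_real_spectrum (C : numClosedFieldType) n (M : 'M[C]_n) :
    (forall a, eigenvalue M a -> a \is Num.real) ->
  0 <= \tr (M *m M) /\ (\tr (M *m M) = 0 -> M ^+ n = 0).
Proof.
case: n M => [|n] M realM.
  by rewrite /mxtrace big_ord0; split=> // _; apply: thinmx0.
have [P Pu trigP] := Schur M (ltn0Sn n).
have Pun : P \in unitmx by apply: unitarymx_unit.
(* [U] is kept opaque so that rewriting does not see through it *)
have [U defU] : exists U, U = P *m M *m invmx P by eexists.
have trigU : is_trig_mx U by rewrite defU -conjumx.
have defM : M = invmx P *m U *m P.
  by rewrite defU !mulmxA mulVmx // mul1mx -mulmxA mulVmx // mulmx1.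
(* the diagonal entries of [U] are eigenvalues of [M], hence real *)
have eigU i : eigenvalue M (U i i).
  have /eigenvalueP[v vU v0] : eigenvalue U (U i i).
    rewrite eigenvalue_root_char char_poly_trig // (bigD1 i) //= rootM.
    by rewrite root_XsubC eqxx.
  apply/eigenvalueP; exists (v *m P).
    by rewrite {1}defM !mulmxA mulmxK // vU scalemxAl.
  by apply/eqP => vP0; case/eqP: v0; rewrite -[v](mulmxK Pun) vP0 mul0mx.
have trE : \tr (M *m M) = \sum_i U i i ^+ 2.
  rewrite defM -!mulmxA mulKVmx // mxtrace_mulC -!mulmxA mulmxV // mulmx1.
  apply: eq_bigr => i _; rewrite mxE (bigD1 i) //= big1 ?addr0 ?expr2 //.
  move=> j ji; case: (ltngtP i j) => [ij | ij | /val_inj ij].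
  - by rewrite (is_trig_mxP trigU) ?mul0r.
  - by rewrite [U j i](is_trig_mxP trigU) ?mulr0.
  - by rewrite ij eqxx in ji.
have sq0 i : 0 <= U i i ^+ 2 by rewrite real_exprn_even_ge0 // realM.
split; first by rewrite trE; apply: sumr_ge0.
rewrite trE => /eqP; rewrite psumr_eq0 // => /allP U0.
have U_nil : U ^+ n.+1 = 0.
  have := Cayley_Hamilton U; rewrite char_poly_trig // (eq_bigr (fun=> 'X)).
    by rewrite prodr_const card_ord rmorphXn /= horner_mx_X.
  move=> i _; have := U0 i (mem_index_enum i); rewrite /= expf_eq0 /= => /eqP->.
  by rewrite subr0.
have powM k : M ^+ k = invmx P *m U ^+ k *m P.
  elim: k => [|k IHk]; first by rewrite !expr0 mulmx1 mulVmx.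
  by rewrite !exprS -!mulmxE {1}defM IHk !mulmxA mulmxK.
by rewrite powM U_nil mulmx0 mul0mx.
Qed.

(** Diagonalize by a unitary matrix and take square roots of the eigenvalues. *)
Lemma psd_factor (C : numClosedFieldType) n (H : 'M[C]_n) :
    H = H ^t* -> (forall v : 'rV_n, 0 <= (v *m H *m v ^t*) 0 0) ->
  exists M : 'M[C]_n, H = M *m M ^t*.
Proof.
move=> herH psdH.
have nH : H \is normalmx by apply/normalmxP; rewrite -herH.
set P := spectralmx H; set d := spectral_diag H.
have Pu : P \is unitarymx by apply: spectral_unitarymx.
have defH : H = P ^t* *m diag_mx d *m P.
  by rewrite -invmx_unitary //; exact/orthomx_spectralP.
have PP : P *m P ^t* = 1%:M by apply/unitarymxP.
have diagH : P *m H *m P ^t* = diag_mx d.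
  by rewrite defH !mulmxA PP mul1mx -mulmxA PP mulmx1.
have d0 i : 0 <= d 0 i.
  have -> : d 0 i = (P *m H *m P ^t*) i i by rewrite diagH mxE eqxx.
  have := psdH (row i P); rewrite -row_mul.
  rewrite [X in 0 <= X -> _]mxE [X in _ -> 0 <= X]mxE.
  by under eq_bigr do rewrite !mxE; under [in X in _ -> X]eq_bigr do rewrite !mxE.
pose e : 'rV[C]_n := \row_i sqrtC (d 0 i).
exists (P ^t* *m diag_mx e).
rewrite trmx_mul map_mxM trmxCK tr_diag_mx map_diag_mx !mulmxA -(mulmxA (P ^t*)).
rewrite mulmx_diag {1}defH; congr (_ *m diag_mx _ *m _).
apply/rowP=> i; rewrite !mxE /= conj_Creal ?ger0_real ?sqrtC_ge0 //.
by rewrite -expr2 sqrtCK.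
Qed.

(** * Mean ergodic theorem for bounded orbits of a matrix *)

Lemma complex_archi (R : realType) (x D : R[i]) :
  0 <= x -> (forall n, x *+ n <= D) -> x = 0.
Proof.
move=> x0 xD; have D0 : 0 <= D by have := xD 0%N; rewrite mulr0n.
apply/eqP; rewrite eq_le x0 andbT.
have := ger0_real x0; have := ger0_real D0.
move=> /complex_realP[s defD] /complex_realP[r defx]; subst x D.
rewrite lecR leNgt; apply/negP => r0; rewrite !lecR in x0 D0.
have := xD (Num.bound (s / r)); rewrite -rmorphMn lecR leNgt /=.
by rewrite -mulr_natl -ltr_pdivrMr // archi_boundP // divr_ge0 // ltW.
Qed.

Section MeanErgodic.
Context {R : realType} {n : nat}.
Implicit Types (M : 'M[R[i]]_n) (y z : 'rV[R[i]]_n).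

Definition bounded_orbit M y :=
  exists D, forall k j, `|(y *m M ^+ k) 0 j| <= D.

Lemma bounded_orbit_comb M y z (c : R[i]) :
  bounded_orbit M y -> bounded_orbit M z -> bounded_orbit M (c *: y + z).
Proof.
move=> [D yD] [E zE]; exists (`|c| * D + E) => k j.
rewrite mulmxDl -scalemxAl mxE [X in X + _]mxE (le_trans (ler_normD _ _)) //.
rewrite lerD ?zE // normrM ler_wpM2l ?yD //.
Qed.

Lemma bounded_orbit_pow M y i : bounded_orbit M y -> bounded_orbit M (y *m M ^+ i).
Proof. by move=> [D yD]; exists D => k j; rewrite -mulmxA mulmxE -exprD. Qed.

(** A Jordan block of size 2 for the eigenvalue 1 produces an orbit that grows
linearly; larger blocks reduce to this case by applying [M - 1]. *)
Lemma bounded_orbit_unipotent M y m :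
  bounded_orbit M y -> y *m (M - 1%:M) ^+ m = 0 -> y *m M = y.
Proof.
elim: m y => [|m IHm] y bdy.
  by rewrite expr0 mulmx1 => ->; rewrite mul0mx.
rewrite exprS -mulmxE mulmxA => /IHm; set z := y *m _.
have zE : z = y *m M - y by rewrite /z mulmxBr mulmx1.
have bdz : bounded_orbit M z.
  rewrite zE addrC -scaleN1r; apply: bounded_orbit_comb => //.
  by rewrite -[M]expr1; apply: bounded_orbit_pow; rewrite expr1.
move=> /(_ bdz) zM; apply/eqP; rewrite -subr_eq0 -zE; apply/eqP/rowP => j.
(* [z] is fixed by [M], so the orbit of [y] grows linearly *)
have yM k : y *m M ^+ k = y + z *+ k.
  elim: k => [|k IHk]; first by rewrite expr0 mulmx1 addr0.
  have zkM : z *+ k *m M = z *+ k by rewrite -[z *+ k]scaler_nat -scalemxAl zM.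
  rewrite exprSr -mulmxE mulmxA IHk mulmxDl zkM (mulrSr z k) [z *+ k + z]addrC.
  by rewrite addrA zE addrC (addrC y) subrK addrC.
have [D yD] := bdy; clearbody z; clear zE.
rewrite [RHS]mxE; apply: normr0_eq0.
apply: (@complex_archi _ _ (D + D)) => // k.
have -> : `|z 0 j| *+ k = `|(y *m M ^+ k) 0 j - (y *m M ^+ 0) 0 j|.
  by rewrite yM expr0 mulmx1 !mxE addrAC subrr add0r mulmxnE normrMn.
by rewrite (le_trans (ler_normB _ _)) // lerD.
Qed.
End MeanErgodic.

(** Write the characteristic polynomial as [Q * ('X - 1)^m] with [Q.[1] <> 0].
By Cayley-Hamilton, [v Q(M)] is killed by [(M - 1)^m], hence fixed by [M] since
its orbit is bounded; [q] is [Q] normalized at 1. *)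
Lemma mean_ergodic_combination (R : realType) n (M : 'M[R[i]]_n) v :
    bounded_orbit M v ->
  exists2 q : {poly R[i]}, q.[1] = 1 &
    let w := \sum_(i < size q) q`_i *: (v *m M ^+ i) in w *m M = w.
Proof.
case: n M v => [|n] M v bdv.
  by exists 1; rewrite ?hornerC //; apply/rowP; case.
have [m [Q Q1 defP]] := multiplicity_XsubC (char_poly M) 1.
have {}Q1 : Q.[1] != 0.
  by move: Q1; rewrite monic_neq0 ?char_poly_monic.
pose q := Q.[1]^-1 *: Q.
have q1 : q.[1] = 1 by rewrite hornerZ mulVf.
exists q => //=; set w := \sum_i _.
have defw : w = v *m horner_mx M q.
  have -> : horner_mx M q = \sum_(i < size q) q`_i *: M ^+ i.
    rewrite -{1}[q]coefK poly_def linear_sum; apply: eq_bigr => i _.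
    by rewrite linearZ /= rmorphXn /= horner_mx_X.
  rewrite mulmx_sumr; apply: eq_bigr => i _.
  by rewrite scalemxAr.
have bdw : bounded_orbit M w.
  rewrite /w; elim/big_ind: _ => [|x y bx by_|i _].
  - by exists 0 => k j; rewrite mul0mx mxE normr0.
  - by rewrite -[x]scale1r; apply: bounded_orbit_comb.
  - rewrite -[_ *: _]addr0; apply: bounded_orbit_comb.
      exact: bounded_orbit_pow.
    by exists 0 => k j; rewrite mul0mx mxE normr0.
apply: (@bounded_orbit_unipotent _ _ _ _ m) => //.
rewrite defw -mulmxA.
have := Cayley_Hamilton M; rewrite defP rmorphM rmorphXn /= rmorphB /= horner_mx_X.
rewrite horner_mx_C => ch; rewrite /q linearZ /= -scalemxAl mulmxE ch.
by rewrite scaler0 mulmx0.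
Qed.

(** Shifting [s] changes its sum over [N] terms by a bounded amount, so [N h]
stays within a bounded distance of the nonnegative partial sums of [s]. *)
Lemma cesaro_ge0 (R : realType) (s : nat -> R[i]) (q : {poly R[i]}) (D h : R[i]) :
    (forall k, 0 <= s k <= D) -> q.[1] = 1 ->
    (forall k, \sum_(i < size q) q`_i * s (k + i)%N = h) ->
  0 <= h.
Proof.
move=> sD q1 avg.
pose A N := \sum_(k < N) s k.
(* total shift error, independent of the length of the average *)
pose E := \sum_(i < size q) `|q`_i| * (D *+ i).
have A0 N : 0 <= A N by apply: sumr_ge0 => k _; have /andP[] := sD k.
have shiftA N i : `|\sum_(k < N) s (k + i)%N - A N| <= D *+ i.
  elim: i => [|i IHi].
    by under eq_bigr do rewrite addn0; rewrite subrr normr0.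
  have -> : \sum_(k < N) s (k + i.+1)%N = \sum_(k < N) s (k + i)%N + (s (N + i)%N - s i).
    have := @big_ord_recr _ 0 +%R N (fun k => s (k + i)%N); rewrite big_ord_recl /=.
    under [X in _ + X = _]eq_bigr do rewrite /bump addSnnS.
    by rewrite addrA => <-; rewrite addrAC subrr add0r.
  rewrite addrAC mulrSr (le_trans (ler_normD _ _)) // lerD //.
  have [/andP[a0 aD] /andP[b0 bD]] := (sD (N + i)%N, sD i).
  have D0 := le_trans a0 aD.
  rewrite real_ler_norml ?rpredB ?ger0_real //; apply/andP; split.
    by rewrite lerBrDr (le_trans _ a0) // addrC subr_le0.
  by rewrite lerBlDr (le_trans aD) // lerDl.
have hA N : `|h *+ N - A N| <= E.
  have -> : h *+ N - A N = \sum_(i < size q) q`_i * (\sum_(k < N) s (k + i)%N - A N).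
    under [RHS]eq_bigr do rewrite mulrBr mulr_sumr.
    rewrite sumrB -mulr_suml exchange_big /=; congr (_ - _).
      by under eq_bigr do rewrite avg; rewrite sumr_const card_ord.
    rewrite -[LHS]mul1r -q1 horner_coef; congr (_ * _); apply: eq_bigr => i _.
    by rewrite expr1n mulr1.
  rewrite (le_trans (ler_norm_sum _ _ _)) //; apply: ler_sum => i _.
  by rewrite normrM ler_wpM2l.
(* [h] and its modulus are both within [E / N] of the same nonnegative mean *)
suff -> : h = `|h| by [].
apply/eqP; rewrite -subr_eq0 -normr_eq0; apply/eqP.
apply: (@complex_archi _ _ (E + E)) => // N.
rewrite -normrMn mulrnBl -(subrKA (A N)).
rewrite (le_trans (ler_normD _ _)) // lerD // -normrMn.
by rewrite -[X in X - _](ger0_norm (A0 N)) (le_trans (ler_dist_dist _ _)) // distrC.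
Qed.

(** * Positive semidefinite sesquilinear forms *)

Section PositiveForm.
Context {R : realType} {V : lmodType R[i]}.
Variable B : V -> V -> R[i].
Hypotheses (Bl : forall a x y z, B (a *: x + y) z = a^* * B x z + B y z)
  (Br : forall a x y z, B x (a *: y + z) = a * B x y + B x z)
  (B_ge0 : forall x, 0 <= B x x).

(** Polarization: [B (c x + y) (c x + y)] is real, for [c = 1] and for
[c = 'i]. *)
Lemma form_hermitian x y : B x y = (B y x)^*.
Proof.
have quad c : B (c *: x + y) (c *: x + y) =
    c^* * c * B x x + c^* * B x y + c * B y x + B y y.
  by rewrite Bl !Br; ring.
have real c : (c^* * B x y + c * B y x)^* = c^* * B x y + c * B y x.
  apply/conj_Creal.
  have -> : c^* * B x y + c * B y x =
      B (c *: x + y) (c *: x + y) - c^* * c * B x x - B y y.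
    by rewrite quad; ring.
  by rewrite !rpredB ?ger0_real // mulr_ge0 // mulrC mul_conjC_ge0.
have := real 1; have := real 'i.
rewrite !(rmorphD, rmorphM) /= !conjCi !conjCK conjC1 !mul1r.
set a := B x y; set b := B y x => eqi eq1.
have {}eqi : a - b = b^* - a^*.
  have {}eqi : 'i * a^* - 'i * b^* = - 'i * a + 'i * b.
    by rewrite -eqi rmorphN /= conjCi opprK mulNr.
  apply: (mulfI (neq0Ci R[i])).
  have -> : 'i * (a - b) = - (- 'i * a + 'i * b) by ring.
  by rewrite -eqi; ring.
have : 2 * a = 2 * b^* by rewrite (_ : 2 * a = (a + b) + (a - b)); [rewrite -eq1 eqi|]; ring.
by apply: mulfI; rewrite pnatr_eq0.
Qed.

(** The degenerate case of the Cauchy-Schwarz inequality: moving [y] along [x]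
changes [B y y] linearly, which positivity forbids unless the slope is 0. *)
Lemma form_null x : B x x = 0 -> forall y, B y x = 0.
Proof.
move=> Bxx y.
have ge s : B y x * (B y x)^* *+ s <= B y y.
  have := B_ge0 ((- (s%:R * (B y x)^*)) *: x + y).
  rewrite Bl !Br Bxx (form_hermitian x) rmorphN rmorphM /= conjCK conjC_nat.
  set b := B y x => pos.
  have sb0 : 0 <= s%:R * (b * b^*) by rewrite mulr_ge0 ?ler0n ?mul_conjC_ge0.
  rewrite -mulr_natl -subr_ge0; have := addr_ge0 pos sb0.
  by congr (0 <= _); ring.
have := complex_archi (mul_conjC_ge0 _) ge.
by move/eqP; rewrite mul_conjC_eq0 => /eqP.
Qed.

End PositiveForm.

(** * The trace of the left regular representation *)

Section FiniteCStar.
Context {R : realType} {A : finCStarAlgType R}.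
Implicit Types (x y z : A) (f : {scalar A}).

Lemma starD x y : star (x + y) = star x + star y.
Proof. by rewrite -[x in LHS]scale1r star_conj_linear rmorph1 scale1r. Qed.

Lemma star0 : star (0 : A) = 0.
Proof. by apply: (addrI (star 0)); rewrite -starD !addr0. Qed.

Lemma starZ (c : R[i]) x : star (c *: x) = c^* *: star x.
Proof. by rewrite -[c *: x]addr0 star_conj_linear star0 addr0. Qed.

Lemma starN x : star (- x) = - star x.
Proof. by rewrite -scaleN1r starZ rmorphN rmorph1 scaleN1r. Qed.

Lemma star1 : star (1 : A) = 1.
Proof. by rewrite -[LHS]mul1r -{1}[1](@starK R A) -starM mul1r starK. Qed.

Lemma star_sum (I : Type) (r : seq I) (P : pred I) (F : I -> A) :
  star (\sum_(i <- r | P i) F i) = \sum_(i <- r | P i) star (F i).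
Proof. exact: (big_morph _ starD star0). Qed.

Lemma complement_projection (p : A) : star p = p -> p * p = p ->
  [/\ star (1 - p) = 1 - p, (1 - p) * p = 0 & (1 - p) * (1 - p) = 1 - p].
Proof.
move=> ps pp; have up : (1 - p) * p = 0 by rewrite mulrBl mul1r pp subrr.
by split=> //; rewrite ?starD ?starN ?star1 ?ps // mulrBr up mulr1 subr0.
Qed.

Lemma star_proper x : star x * x = 0 -> x = 0.
Proof.
move=> xx; apply: cstar_norm_eq0; apply/eqP; rewrite -sqrf_eq0 -cstar_norm_star.
have := @cstar_normZ R A 0 0; rewrite scale0r xx => ->.
by rewrite ComplexField.Normc.normc0 mul0r.
Qed.

Definition positive f := forall x, 0 <= f (star x * x).

Lemma positive_herm f x y :
  positive f -> f (star x * y) = (f (star y * x))^*.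
Proof.
move=> pf; apply: (form_hermitian (B := fun u v => f (star u * v))) => //.
- by move=> a u v w; rewrite star_conj_linear mulrDl -scalerAl linearP.
- by move=> a u v w; rewrite mulrDr -scalerAr linearP.
Qed.

Lemma positive_star f x : positive f -> f (star x) = (f x)^*.
Proof.
by move=> pf; have := positive_herm x 1 pf; rewrite mulr1 star1 mul1r.
Qed.

Lemma positive_null f x : positive f -> f (star x * x) = 0 -> forall y, f (y * x) = 0.
Proof.
move=> pf fx y; rewrite -[y]starK.
apply: (form_null (B := fun u v => f (star u * v))) => //.
- by move=> a u v w; rewrite star_conj_linear mulrDl -scalerAl linearP.
- by move=> a u v w; rewrite mulrDr -scalerAr linearP.
Qed.

(** Positivity at [x - f x]. *)
Lemma state_bound f x : positive f -> f 1 = 1 -> `|f x| ^+ 2 <= f (star x * x).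
Proof.
move=> pf f1; rewrite -subr_ge0.
have := pf (x - f x *: 1); congr (0 <= _).
rewrite starD starN starZ star1 mulrBr !mulrBl !linearB /= -!scalerAr -!scalerAl.
rewrite !mulr1 mul1r !linearZ /= f1 positive_star // normCK /GRing.scale /=; ring.
Qed.

Definition left_mul_mx x : 'M[R[i]]_(dim A) :=
  \matrix_(i, j) v2r (x * tbasis i) 0 j.

Lemma mul_left_mul_mx v x : v *m left_mul_mx x = v2r (x * r2v v).
Proof.
rewrite [r2v v]tbasis_sum r2vK mulr_sumr linear_sum /=.
apply/rowP=> j; rewrite mxE summxE; apply: eq_bigr => i _.
by rewrite -scalerAr linearZ !mxE.
Qed.

Lemma left_mul_mxM x y : left_mul_mx (x * y) = left_mul_mx y *m left_mul_mx x.
Proof.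
apply/row_matrixP=> i; rewrite !rowE mulmxA !mul_left_mul_mx v2rK mulrA //.
Qed.

Lemma left_mul_mx_is_linear : linear left_mul_mx.
Proof.
move=> a x y; apply/matrixP=> i j.
by rewrite !mxE mulrDl -scalerAl linearP !mxE.
Qed.

(** For a full matrix algebra of size [n] this is [n] times the usual trace. *)
Definition regular_trace x : R[i]^o := \tr (left_mul_mx x).

Lemma regular_trace_is_linear : linear regular_trace.
Proof. by move=> a x y; rewrite /regular_trace left_mul_mx_is_linear linearP. Qed.

HB.instance Definition _ := GRing.isLinear.Build R[i] A R[i]^o _ regular_trace
  regular_trace_is_linear.

Lemma regular_traceC x y : regular_trace (x * y) = regular_trace (y * x).
Proof. by rewrite /regular_trace !left_mul_mxM mxtrace_mulC. Qed.

(** If [x y = a y] then [y^* x y] is both [a y^* y] and [a^* y^* y]. *)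
Lemma selfadjoint_eigenvalue_real x a :
  star x = x -> eigenvalue (left_mul_mx x) a -> a \is Num.real.
Proof.
move=> xx /eigenvalueP[v]; rewrite mul_left_mul_mx => /(congr1 r2v).
rewrite v2rK linearZ /=; set y := r2v v => xy v0.
have y0 : star y * y != 0.
  apply: contraNneq v0 => /star_proper y0; rewrite -[v]r2vK -/y y0 linear0 //.
apply/CrealP.
have e : star y * x * y = a *: (star y * y) by rewrite -mulrA xy scalerAr.
have := congr1 (@star R A) e; rewrite starZ !starM starK xx mulrA e.
by move=> /eqP; rewrite -subr_eq0 -scalerBl scaler_eq0 (negPf y0) orbF subr_eq0 => /eqP <-.
Qed.

Lemma selfadjoint_nilpotent x n : star x = x -> x ^+ n = 0 -> x = 0.
Proof.
move=> xx; case: n => [|n]; first by rewrite expr0 => /eqP; rewrite oner_eq0.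
elim: n => [|n IHn xn0]; first by rewrite expr1.
apply: IHn; apply: star_proper.
have starX k : star (x ^+ k) = x ^+ k.
  elim: k => [|k IHk]; first exact: star1.
  by rewrite exprS starM IHk xx -exprSr exprS.
rewrite starX.
by rewrite -exprD addnS -addSn exprD xn0 mul0r.
Qed.

Lemma regular_trace_sqr x : star x = x ->
  0 <= regular_trace (x * x) /\ (regular_trace (x * x) = 0 -> x = 0).
Proof.
move=> xx; have := mxtrace_sqr_real_spectrum (fun a => selfadjoint_eigenvalue_real xx).
rewrite /regular_trace left_mul_mxM => -[-> tr0]; split=> // /tr0 nil.
apply: (@selfadjoint_nilpotent _ (dim A)) => //.
have powx k : left_mul_mx x ^+ k = left_mul_mx (x ^+ k).
  elim: k => [|k IHk].
    apply/row_matrixP=> i; rewrite !expr0 rowE [RHS]rowE mul_left_mul_mx mul1r r2vK mulmx1 //.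
  by rewrite exprS IHk exprSr left_mul_mxM.
move: nil; rewrite powx => nil.
by have := mul_left_mul_mx (v2r 1) (x ^+ dim A);
  rewrite nil mulmx0 v2rK mulr1 => /esym/(canRL (@v2rK _ _)) ->; rewrite linear0.
Qed.

Lemma star_re x : star (x + star x) = x + star x.
Proof. by rewrite starD starK addrC. Qed.

Lemma star_im x : star ('i *: (x - star x)) = 'i *: (x - star x).
Proof. by rewrite starZ starD starN starK conjCi scaleNr -scalerN opprB. Qed.

(** With [s = x + star x] and [t = 'i (x - star x)] one has
[s^2 + t^2 = 2 (star x x + x star x)], and the trace identifies the two products.
Positivity at [x^* x] is thereby reduced to squares of self-adjoint elements,
with no spectral theory for [x^* x] itself. *)
Lemma regular_trace_cartesian x :
  4 * regular_trace (star x * x) =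
    regular_trace ((x + star x) * (x + star x)) +
    regular_trace (('i *: (x - star x)) * ('i *: (x - star x))).
Proof.
have ii : 'i * 'i = -1 :> R[i] by rewrite -expr2 sqrCi.
rewrite -scalerAl -scalerAr scalerA ii scaleN1r.
have tD y z : regular_trace (y + z) = regular_trace y + regular_trace z.
  exact: raddfD.
have tN y : regular_trace (- y) = - regular_trace y by exact: raddfN.
rewrite !(mulrDl, mulrDr, mulrN, mulNr) !(tD, tN) (regular_traceC x (star x)).
by ring.
Qed.

Lemma regular_trace_positive : positive regular_trace.
Proof.
move=> x; rewrite -(pmulr_rge0 _ (ltr0n _ 4)) regular_trace_cartesian.
have [re0 _] := regular_trace_sqr (star_re x).
have [im0 _] := regular_trace_sqr (star_im x).
exact: addr_ge0.
Qed.

Lemma regular_trace_faithful x : regular_trace (star x * x) = 0 -> x = 0.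
Proof.
have [y0 yN] := regular_trace_sqr (star_re x).
have [z0 zN] := regular_trace_sqr (star_im x).
move=> x0; have /esym/eqP := regular_trace_cartesian x.
rewrite x0 mulr0 paddr_eq0 // => /andP[/eqP/yN xx /eqP/zN/eqP].
rewrite scaler_eq0 (negPf (neq0Ci _)) subr_eq0 => /eqP xs.
move: xx; rewrite -xs -mulr2n -scaler_nat => /eqP.
by rewrite scaler_eq0 pnatr_eq0 => /eqP.
Qed.

End FiniteCStar.

(** * Orthonormal bases, bounds on states, support projections *)

Section Support.
Context {R : realType} {A : finCStarAlgType R}.
Implicit Types (x y z : A) (f : {scalar A}).
Local Notation tau := (@regular_trace R A).

Lemma regular_trace_nondeg x : (forall y, tau (y * x) = 0) -> x = 0.
Proof. by move=> x0; exact: regular_trace_faithful (x0 (star x)). Qed.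

Definition gram f := \matrix_(i, j) f (star (tbasis i) * tbasis j).

Lemma gramE f (a b : 'rV[R[i]]_(dim A)) :
  (a *m gram f *m b ^t*) 0 0 =
    f (star (\sum_i (a 0 i)^* *: tbasis i) * \sum_j (b 0 j)^* *: tbasis j).
Proof.
rewrite star_sum mulr_suml linear_sum /= -mulmxA mxE; apply: eq_bigr => i _.
rewrite mulr_sumr linear_sum /= mxE mulr_sumr; apply: eq_bigr => j _.
rewrite !mxE starZ conjCK -scalerAl -scalerAr !linearZ /=.
rewrite /GRing.scale /=; ring.
Qed.

Lemma gram_factor f :
  positive f -> exists M : 'M[R[i]]_(dim A), gram f = M *m M ^t*.
Proof.
move=> pf; apply: psd_factor => [|v]; last by rewrite gramE.
by apply/matrixP=> i j; rewrite !mxE; apply/positive_herm.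
Qed.

(** Factor the Gram matrix as [M M^*]; [M] is invertible because the trace is
faithful, and the entrywise conjugate of its inverse is the change of basis. *)
Lemma regular_orthonormal_basis :
  exists e : 'I_(dim A) -> A,
    (forall k l, tau (star (e k) * e l) = (k == l)%:R) /\
    (forall x, x = \sum_k tau (star (e k) * x) *: e k).
Proof.
have [M defG] := gram_factor regular_trace_positive.
have Mu : M \in unitmx.
  rewrite -row_free_unit -kermx_eq0; apply/eqP/row_matrixP=> i.
  rewrite row0; set v := row i _.
  have vM : v *m M = 0 by rewrite -row_mul mulmx_ker row0.
  have := gramE tau v v; rewrite defG mulmxA vM !mul0mx mxE => /esym/regular_trace_faithful v0.
  have : map_mx Num.conj v = 0.
    have : r2v (map_mx Num.conj v) = 0 :> A.
      rewrite [r2v _]tbasis_sum r2vK -[RHS]v0; apply: eq_bigr => j _.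
      by rewrite mxE.
    by move/(congr1 v2r); rewrite r2vK linear0.
  by move/(congr1 (map_mx Num.conj));
  rewrite -map_mx_comp map_mx_id; [rewrite map_mx0 | exact: conjCK].
pose W := map_mx Num.conj (invmx M).
pose e k : A := r2v (row k W).
have Wu : W \in unitmx by rewrite map_unitmx unitmx_inv.
have eE k : e k = \sum_j (row k (invmx M) 0 j)^* *: tbasis j.
  rewrite /e [LHS]tbasis_sum r2vK; apply: eq_bigr => j _.
  by rewrite !mxE.
have e_on k l : tau (star (e k) * e l) = (k == l)%:R.
  rewrite !eE -gramE defG !mulmxA -row_mul mulVmx // -mulmxA.
  rewrite -map_mxM -trmx_mul -[row l _ *m _]row_mul mulVmx // !row1 trmx_delta map_delta_mx.
  by rewrite mul_delta_mx_cond mulmxnE mxE !eqxx.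
exists e; split=> // x.
have defx : x = \sum_k (v2r x *m invmx W) 0 k *: e k.
  apply: (can_inj v2rK).
  rewrite linear_sum /= -{1}[v2r x](mulmxKV Wu) mulmx_sum_row.
  by apply: eq_bigr => k _; rewrite linearZ /= r2vK.
rewrite {1}defx; apply: eq_bigr => k _; congr (_ *: _).
rewrite {2}defx mulr_sumr linear_sum (bigD1 k) //= big1 ?addr0.
  by rewrite -scalerAr linearZ /= e_on eqxx /GRing.scale /= mulr1.
move=> l lk; rewrite -scalerAr linearZ /= e_on eq_sym (negPf lk).
by rewrite /GRing.scale /= mulr0.
Qed.

(** The trace of left multiplication by [x], computed in an orthonormal basis,
is [sum_k tau (e_k^* x e_k) = tau (x c)] with [c = sum_k e_k (star e_k)]; but it
is also [tau x], so [c] is 1. *)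
Lemma casimir :
  exists e : 'I_(dim A) -> A,
    \sum_k e k * star (e k) = 1 /\
    forall x, exists c : 'I_(dim A) -> R[i], x = \sum_k c k *: star (e k).
Proof.
have [e [e_on e_basis]] := regular_orthonormal_basis.
exists e; split; last first.
  move=> x; exists (fun k => (tau (star (e k) * star x))^*).
  rewrite -[LHS]starK {1}[star x]e_basis star_sum.
  by apply: eq_bigr => k _; rewrite starZ.
(* trace computed in the basis [e], with dual basis [tau (e_k^* .)] *)
have traceE x : tau x = \sum_k tau (star (e k) * (x * e k)).
  pose W := \matrix_k v2r (e k).
  pose V := \matrix_(j, k) tau (star (e k) * tbasis j : A).
  have VW : V *m W = 1%:M.
    apply/row_matrixP=> j; rewrite row_mul mulmx_sum_row row1.
    rewrite -[RHS](@r2vK _ A) -/(tbasis j) [tbasis j]e_basis linear_sum /=.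
    by apply: eq_bigr => k _; rewrite !mxE rowK linearZ.
  have -> : tau x = \tr (W *m left_mul_mx x *m V).
    by rewrite mxtrace_mulC mulmxA VW mul1mx.
  apply: eq_bigr => k _.
  have -> : (W *m left_mul_mx x *m V) k k = (row k (W *m left_mul_mx x) *m V) 0 k.
    by rewrite -row_mul [RHS]mxE.
  rewrite row_mul rowK mul_left_mul_mx v2rK mxE.
  rewrite [x * e k in RHS]tbasis_sum mulr_sumr linear_sum /=.
  by apply: eq_bigr => j _; rewrite -scalerAr linearZ [V _ _]mxE.
apply/eqP; rewrite -subr_eq0; apply/eqP/regular_trace_nondeg => x.
rewrite mulrBr mulr1 linearB /=; apply/eqP; rewrite subr_eq0; apply/eqP.
rewrite mulr_sumr linear_sum /= traceE; apply: eq_bigr => k _.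
by rewrite regular_traceC mulrA.
Qed.

(** A state takes on each [e_k e_k^*] of [casimir] a value in [0, 1], hence has
modulus at most 1 at each [e_k^*]. *)
Lemma states_bounded x :
  exists D, forall f, positive f -> f 1 = 1 -> `|f x| <= D.
Proof.
have [e [e1 /(_ x) [c ->]]] := casimir.
exists (\sum_k `|c k|) => f pf f1.
rewrite linear_sum (le_trans (ler_norm_sum _ _ _)) //; apply: ler_sum => k _.
rewrite linearZ normrM ler_piMr //.
rewrite -(@ler_pXn2r _ 2) ?nnegrE // expr1n.
rewrite (le_trans (state_bound _ pf f1)) // starK -f1 -e1 linear_sum (bigD1 k) //=.
by rewrite lerDl sumr_ge0 // => l _; rewrite -{1}[e l]starK.
Qed.

(** [u] is the orthogonal projection of 1 on the null ideal of [f], for the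
inner product given by [tau]. *)
Lemma null_ideal_projection f : positive f ->
  exists2 u, f (star u * u) = 0 &
    forall y, f (star y * y) = 0 -> tau (star y * (1 - u)) = 0.
Proof.
move=> pf.
have [e [e_on e_basis]] := regular_orthonormal_basis.
pose K := \matrix_(k, j) f (tbasis j * e k).
pose vec (c : 'rV_(dim A)) : A := \sum_k c 0 k *: e k.
have vecB : {morph vec : c d / c - d}.
  move=> c d; rewrite -sumrB; apply: eq_bigr => k _.
  by rewrite !mxE scalerBl.
have vecK c : f (star (vec c) * vec c) = 0 <-> (c <= kermx K)%MS.
  have fvec j : f (tbasis j * vec c) = (c *m K) 0 j.
    rewrite mulr_sumr linear_sum mxE; apply: eq_bigr => k _.
    by rewrite -scalerAr linearZ [K _ _]mxE.
  split=> [/(positive_null pf) c0 | /sub_kermxP c0].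
    by apply/sub_kermxP/rowP => j; rewrite -fvec c0 mxE.
  rewrite [star _]tbasis_sum mulr_suml linear_sum big1 // => j _.
  by rewrite -scalerAl linearZ /= fvec c0 mxE mulr0.
have vec_form c d : tau (star (vec c) * vec d) = (d *m c ^t*) 0 0.
  rewrite star_sum mulr_suml linear_sum mxE; apply: eq_bigr => k _.
  rewrite mulr_sumr linear_sum (bigD1 k) //= big1 => [|l lk].
    rewrite starZ -scalerAl -scalerAr !linearZ /= e_on eqxx !mxE addr0.
    by rewrite /GRing.scale /=; ring.
  rewrite starZ -scalerAl -scalerAr !linearZ /= e_on eq_sym (negPf lk).
  by rewrite /GRing.scale /= !mulr0.
pose c1 : 'rV_(dim A) := \row_k tau (star (e k) * 1).
have vec1 : vec c1 = 1.
  by rewrite [RHS]e_basis; apply: eq_bigr => k _; rewrite mxE.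
exists (vec (c1 *m proj_ortho (kermx K))); first exact/vecK/proj_ortho_sub.
move=> y.
pose d : 'rV_(dim A) := \row_k tau (star (e k) * y).
have -> : y = vec d.
  by rewrite [LHS]e_basis; apply: eq_bigr => k _; rewrite mxE.
move=> /vecK/submxP[D defd]; rewrite -[X in X - _]vec1 -vecB vec_form.
have /orthomx1P perp := proj_ortho_compl_sub (kermx K) c1.
by rewrite defd trmx_mul map_mxM mulmxA perp mul0mx mxE.
Qed.

(** The null ideal and its orthogonal complement are both left ideals, so the
orthogonal decomposition [1 = u + p] yields idempotents; the trace property
makes them self-adjoint. *)
Lemma support_projection f : positive f ->
  exists2 p, star p = p /\ p * p = p & forall x, f (star x * x) = 0 <-> x * p = 0.
Proof.
move=> pf.
pose N x := f (star x * x) = 0.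
have NP x : N x <-> forall y, f (y * x) = 0.
  by split=> [/positive_null|]; apply.
have NM y x : N x -> N (y * x).
  by move=> /NP x0; apply/NP => z; rewrite mulrA.
have [u Nu orth] := null_ideal_projection pf.
pose p := 1 - u.
have up1 : u + p = 1 by rewrite addrC subrK.
have Np x : N x -> x * p = 0.
  move=> Nx; apply: regular_trace_faithful.
  have Nxp : N (x * p).
    apply/NP => y; rewrite mulrBr mulr1 mulrBr linearB /=.
    by move/NP: Nx => ->; rewrite !mulrA; move/NP: Nu => ->; rewrite subr0.
  have := orth _ (NM (star x) _ Nxp); rewrite starM starK => <-.
  by rewrite mulrA.
have pp : p * p = p.
  by have := congr1 ( *%R^~ p) up1; rewrite mulrDl Np // add0r mul1r.
have pu : p * star u = 0.
  apply: regular_trace_nondeg => a.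
  rewrite mulrA regular_traceC mulrA -[a]starK -starM.
  by apply: orth; apply: NM.
have uu : u = u * star u.
  have := congr1 (@star R A) pu; rewrite starM starK star0 => up.
  by rewrite -{1}[u]mulr1 -star1 -up1 starD mulrDr up addr0.
have us : star u = u by rewrite {1}uu starM starK -uu.
have ps : star p = p by rewrite starD starN star1 us.
exists p => // x; split; first exact: Np.
by move=> xp; rewrite -[x]mulr1 -up1 mulrDr xp addr0; apply: NM.
Qed.
End Support.

(** * Slice maps on tensor products *)

Section Slice.
Context {K : fieldType}.

Lemma tmap_is_linear (U V U' V' : vectType K) (f : U -> U') (g : V -> V') :
  linear (tmap f g).
Proof. exact: tlift_is_linear. Qed.

HB.instance Definition _ (U V U' V' : vectType K) (f : U -> U') (g : V -> V') :=
  GRing.isLinear.Build K (tensor U V) (tensor U' V') _ (tmap f g) (tmap_is_linear f g).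

Lemma tassoc_is_linear (U V W : vectType K) : linear (@tassoc K U V W).
Proof. exact: tlift_is_linear. Qed.

HB.instance Definition _ (U V W : vectType K) :=
  GRing.isLinear.Build K (tensor (tensor U V) W) (tensor U (tensor V W)) _
    (@tassoc K U V W) (@tassoc_is_linear U V W).

Lemma tmap_tens (U V U' V' : vectType K) (f : {linear U -> U'}) (g : {linear V -> V'}) u v :
  tmap f g (tens u v) = tens (f u) (g v).
Proof.
rewrite /tmap tlift_tens // => w c x y; first by rewrite linearP tensDl.
by rewrite linearP tensDr.
Qed.

Lemma tassoc_tens (U V W : vectType K) (t : tensor U V) (w : W) :
  tassoc (tens t w) = tlift (fun u v => tens u (tens v w)) t.
Proof.
rewrite /tassoc tlift_tens // => [w'|t']; first exact: tlift_is_linear.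
apply: tlift_linear_in => u v c x y.
by rewrite tensDr tensDr.
Qed.

Section SliceDef.
Context {U V : vectType K}.

(** The slice map [id (x) g]. *)
Definition slice (g : V -> K) (t : tensor U V) : U :=
  tlift (fun u v => g v *: u) t.

Lemma slice_is_linear g : linear (slice g).
Proof. exact: tlift_is_linear. Qed.

HB.instance Definition _ g :=
  GRing.isLinear.Build K (tensor U V) U _ (slice g) (slice_is_linear g).

Lemma slice_tens (g : {scalar V}) u v : slice g (tens u v) = g v *: u.
Proof.
rewrite /slice tlift_tens // => w c x y; first by rewrite scalerDr !scalerA mulrC.
by rewrite linearP scalerDl scalerA.
Qed.

(** The functional [f (x) g]. *)
Definition tpair (f : U -> K) (g : V -> K) (t : tensor U V) : K^o :=
  tlift (fun u v => f u * g v : K^o) t.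

Lemma tpair_is_linear f g : linear (tpair f g).
Proof. exact: tlift_is_linear. Qed.

HB.instance Definition _ f g :=
  GRing.isLinear.Build K (tensor U V) K^o _ (tpair f g) (tpair_is_linear f g).

Lemma tpair_slice (f : {scalar U}) (g : V -> K) t : tpair f g t = f (slice g t).
Proof.
rewrite /tpair /slice /tlift linear_sum; apply: eq_bigr => i _.
rewrite linear_sum; apply: eq_bigr => j _.
have fZ (k : K) u : f (k *: u) = k * f u by rewrite linearZ.
by rewrite !fZ (mulrC (g _) (f _)).
Qed.

Lemma eq_slice (g g' : V -> K) : g =1 g' -> slice g =1 slice g'.
Proof.
by move=> gg t; apply: eq_bigr => i _; apply: eq_bigr => j _; rewrite gg.
Qed.

Lemma sliceZ (c : K) (g : V -> K) t : slice (fun v => c * g v) t = c *: slice g t.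
Proof.
rewrite scaler_sumr; apply: eq_bigr => i _; rewrite scaler_sumr.
by apply: eq_bigr => j _; rewrite !scalerA mulrCA mulrA.
Qed.

Lemma slice_sum n (g : 'I_n -> V -> K) t :
  slice (fun v => \sum_i g i v) t = \sum_i slice (g i) t.
Proof.
rewrite exchange_big; apply: eq_bigr => i _; rewrite exchange_big.
by apply: eq_bigr => j _; rewrite scaler_suml scaler_sumr.
Qed.

End SliceDef.

(** For positive [g], the common kernel of these functionals over all [c] is the
null ideal of [g]. *)
Definition mulf_left (A : falgType K) (g : A -> K) (c : A) (b : A) : K^o := g (c * b).

Lemma mulf_left_is_linear (A : falgType K) (g : {scalar A}) c : linear (mulf_left g c).
Proof. by move=> a x y; rewrite /mulf_left mulrDr -scalerAr linearP. Qed.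

HB.instance Definition _ (A : falgType K) (g : {scalar A}) c :=
  GRing.isLinear.Build K A K^o _ (mulf_left g c) (mulf_left_is_linear g c).

Section SliceAlgebra.
Context {A B : falgType K}.
Implicit Types (t : tensor A B) (g : {scalar B}).

Lemma tens_mul (a a' : A) (b b' : B) : tens a b * tens a' b' = tens (a * a') (b * b').
Proof. exact: tmul_tens. Qed.

Lemma slice_mull g a c t :
  slice g (tens a c * t) = a * slice (mulf_left g c) t.
Proof.
move: t; apply: tlift_uniq => [k x y|k x y|u v].
- by rewrite mulrDr -scalerAr linearP.
- by rewrite linearP mulrDr scalerAr.
- by rewrite tens_mul !slice_tens scalerAr.
Qed.

Lemma slice_mulr g a t : slice g (t * tens a 1) = slice g t * a.
Proof.
move: t; apply: tlift_uniq => [k x y|k x y|u v].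
- by rewrite mulrDl -scalerAl linearP.
- by rewrite linearP mulrDl scalerAl.
- by rewrite tens_mul !slice_tens scalerAl mulr1.
Qed.

End SliceAlgebra.
End Slice.

(** * Positivity of tensor products of functionals *)

Section TensorPositivity.
Context {R : realType} {A : finCStarAlgType R}.
Implicit Types (f g : {scalar A}) (t : tensor A A).

Lemma tstar_conj_linear (c : R[i]) s t : tstar (c *: s + t) = c^* *: tstar s + tstar t.
Proof.
rewrite /tstar scaler_sumr -big_split; apply: eq_bigr => i _.
rewrite scaler_sumr -big_split; apply: eq_bigr => j _ /=.
by rewrite !mxE rmorphD rmorphM scalerDl scalerA.
Qed.

Lemma slice_tstar g t : positive g -> slice g (tstar t) = star (slice g t).
Proof.
move=> pg; rewrite /tstar !linear_sum star_sum; apply: eq_bigr => i _.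
rewrite linear_sum star_sum; apply: eq_bigr => j _.
by rewrite linearZ /= slice_tens positive_star // !starZ.
Qed.

(** Factoring the Gram matrix of [g] writes [(f (x) g) (t^* t)] as a finite sum
of values [f (y_k^* y_k)]. *)
Lemma tpair_positive f g : positive f -> positive g ->
  forall t, 0 <= tpair f g (tstar t * t).
Proof.
move=> pf pg t.
have [M defG] := gram_factor pg.
have gE i j : g (star (tbasis i) * tbasis j) = \sum_k M i k * (M j k)^*.
  have -> : g (star (tbasis i) * tbasis j) = gram g i j by rewrite mxE.
  by rewrite defG mxE; apply: eq_bigr => k _; rewrite !mxE.
pose a j : A := \sum_i t i j *: tbasis i.
have defs : tstar t = \sum_j tens (star (a j)) (star (tbasis j)).
  rewrite /tstar exchange_big; apply: eq_bigr => j _.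
  rewrite star_sum; under [in RHS]eq_bigr do rewrite starZ.
  by rewrite (linear_sumZ (tensDl _)).
have deft : t = \sum_j tens (a j) (tbasis j).
  rewrite {1}[t]tensE exchange_big; apply: eq_bigr => j _.
  by rewrite (linear_sumZ (tensDl _)).
have -> : tpair f g (tstar t * t) =
    \sum_k f (star (\sum_j (M j k)^* *: a j) * (\sum_j (M j k)^* *: a j)).
  rewrite defs [X in _ * X]deft mulr_suml linear_sum /=.
  under [RHS]eq_bigr do rewrite star_sum mulr_suml linear_sum /=.
  rewrite [RHS]exchange_big; apply: eq_bigr => i _.
  rewrite mulr_sumr linear_sum /=.
  under [RHS]eq_bigr do rewrite mulr_sumr linear_sum /=.
  rewrite [RHS]exchange_big; apply: eq_bigr => j _.
  rewrite tens_mul tpair_slice slice_tens linearZ /= gE.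
  rewrite /GRing.scale /= mulr_suml; apply: eq_bigr => k _.
  have fZ (c : R[i]) x : f (c *: x) = c * f x by rewrite linearZ.
  by rewrite starZ conjCK -[in RHS]scalerAl -[in RHS]scalerAr !fZ mulrA.
by apply: sumr_ge0.
Qed.

Lemma tpair_null f g t : positive f -> positive g -> tpair f g (tstar t * t) = 0 ->
  forall a c, tpair f g (tens a c * t) = 0.
Proof.
move=> pf pg t0 a c; rewrite -[a]starK -[c]starK -tstar_tens.
apply: (form_null (B := fun u v => tpair f g (tstar u * v))) => //.
- by move=> k u v w; rewrite tstar_conj_linear mulrDl -scalerAl linearP.
- by move=> k u v w; rewrite mulrDr -scalerAr linearP.
- exact: tpair_positive.
Qed.

Lemma slice_null f g t : positive f -> positive g -> (forall x, f (star x * x) = 0 -> x = 0) ->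
   tpair f g (tstar t * t) = 0 -> forall c, slice (mulf_left g c) t = 0.
Proof.
move=> pf pg faith t0 c; apply: faith.
by rewrite -slice_mull -tpair_slice tpair_null.
Qed.

(** Expand [t] over the basis of the first leg: the hypothesis puts each
coefficient in the second leg in the null ideal of [g]. *)
Lemma slice_null_mulr g (p : A) t :
  (forall x, (forall y, g (y * x) = 0) -> x * p = 0) ->
  (forall c, slice (mulf_left g c) t = 0) -> t * tens 1 p = 0.
Proof.
move=> gp t0; pose y i : A := \sum_j t i j *: tbasis j.
have deft : t = \sum_i tens (tbasis i) (y i).
  rewrite {1}[t]tensE; apply: eq_bigr => i _.
  by rewrite (linear_sumZ (tensDr _)).
rewrite deft mulr_suml big1 // => i _; rewrite tens_mul gp.
  by rewrite /tens linear0 mulmx0.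
move=> c; have := t0 c; rewrite deft linear_sum /=.
under eq_bigr do rewrite slice_tens.
move=> /(congr1 v2r)/rowP/(_ i); rewrite linear_sum linear0 summxE (bigD1 i) //= big1.
  by rewrite linearZ /= r2vK !mxE !eqxx mulr1 addr0.
by move=> j ji; rewrite linearZ /= r2vK !mxE eq_sym (negPf ji) andbF mulr0.
Qed.

End TensorPositivity.

(** * Convolution of functionals *)

Section Convolution.
Context {R : realType} {G : finQuantumGroupType R}.
Implicit Types (f g h : {scalar G}) (x y : G).

(** The operator [id (x) f] after [comult].  It turns convolution into
composition ([actA]), which replaces computations with iterated comultiplications
by computations in a module over the convolution algebra. *)
Definition act (f : G -> R[i]) (x : G) : G := slice f (comult x).

Lemma act_is_linear f : linear (act f).
Proof. by move=> a x y; rewrite /act !linearP. Qed.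

HB.instance Definition _ f :=
  GRing.isLinear.Build R[i] G G _ (act f) (act_is_linear f).

Lemma conv_is_linear (f g : G -> R[i]) : linear (conv f g : G -> R[i]^o).
Proof. by move=> a x y; rewrite /conv !linearP. Qed.

HB.instance Definition _ (f g : G -> R[i]) :=
  GRing.isLinear.Build R[i] G R[i]^o _ (conv f g) (conv_is_linear f g).

Lemma conv_tpair f g x : conv f g x = tpair f g (comult x).
Proof. by []. Qed.

Lemma conv_act f (g : G -> R[i]) x : conv f g x = f (act g x).
Proof. exact: tpair_slice. Qed.

(** Both sides come from slicing the two legs on the right of coassociativity by
[f (x) g]. *)
Lemma actA f g x : act f (act g x) = act (conv f g) x.
Proof.
pose tr : tensor G (tensor G G) -> G := slice (tpair f g).
have left_slices s : tr (tassoc s) = slice f (slice g s).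
  move: s; apply: tlift_uniq => [c s s'|c s s'|t w].
  - by rewrite /tr !linearP.
  - by rewrite !linearP.
  rewrite tassoc_tens slice_tens linearZ /=.
  move: t; apply: tlift_uniq => [c s s'|c s s'|u v].
  - by rewrite /tr !linearP.
  - by rewrite !linearP /=.
  rewrite tlift_tens => [|v'|u'].
  - by rewrite /tr slice_tens /= tpair_slice !slice_tens linearZ /= scalerA.
  - exact: tensDl.
  - by move=> c y z; rewrite tensDl tensDr.
have right_slices t : tr (tmap idfun comult t) = slice (conv f g) t.
  move: t; apply: tlift_uniq => [c s s'|c s s'|u v].
  - by rewrite /tr !linearP.
  - by rewrite !linearP.
  by rewrite tmap_tens /tr !slice_tens.
have mid t : slice f (slice g (tmap comult idfun t)) = act f (slice g t).
  move: t; apply: tlift_uniq => [c s s'|c s s'|u v].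
  - by rewrite !linearP.
  - by rewrite !linearP.
  by rewrite tmap_tens !slice_tens /act !linearZ.
by rewrite {2}/act -mid -left_slices comultA right_slices.
Qed.

Lemma convA f g h x : conv f (conv g h) x = conv (conv f g) h x.
Proof. by rewrite !conv_act -actA -conv_act. Qed.

Lemma act_counit x : act counit x = x.
Proof. exact: counitr. Qed.

Lemma act_star f x : positive f -> act f (star x) = star (act f x).
Proof. by move=> pf; rewrite /act comult_star slice_tstar. Qed.

Lemma act1 f : act f 1 = f 1 *: 1.
Proof. by rewrite /act rmorph1 slice_tens. Qed.

Lemma conv_positive f g : positive f -> positive g -> positive (conv f g).
Proof.
by move=> pf pg x; rewrite /= conv_tpair rmorphM /= comult_star tpair_positive.
Qed.

Lemma conv1 f g : conv f g 1 = f 1 * g 1.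
Proof. by rewrite conv_act act1 linearZ mulrC. Qed.

Lemma conv_pow_is_linear f k : linear (conv_pow f k : G -> R[i]^o).
Proof.
rewrite /conv_pow; case: k.-1 => [|n] a x y; first by rewrite /= linearP.
by rewrite iterS linearP.
Qed.

HB.instance Definition _ f k :=
  GRing.isLinear.Build R[i] G R[i]^o _ (conv_pow f k) (conv_pow_is_linear f k).

Lemma conv_powS f k x : conv_pow f k.+2 x = conv f (conv_pow f k.+1) x.
Proof. by []. Qed.

Lemma eq_conv f (g g' : G -> R[i]) : g =1 g' -> conv f g =1 conv f g'.
Proof. by move=> gg x; rewrite !conv_act /act (eq_slice gg). Qed.

Lemma conv_powSr f k x : conv_pow f k.+2 x = conv_pow f k.+1 (act f x).
Proof.
elim: k x => [|k IHk] x; first exact: conv_act.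
rewrite conv_powS [RHS]conv_powS -[RHS]conv_act -convA.
by apply: eq_conv => y; rewrite IHk conv_act.
Qed.

Lemma conv_pow_state f k : positive f -> f 1 = 1 ->
  positive (conv_pow f k.+1) /\ conv_pow f k.+1 1 = 1.
Proof.
move=> pf f1; elim: k => [//|k [pk k1]]; split.
  by move=> x; exact: conv_positive pf pk x.
by rewrite conv_powS conv1 f1 /= k1 mulr1.
Qed.

Definition antipode_coord i (x : G) : R[i]^o := v2r (antipode x) 0 i.

Lemma antipode_coord_is_linear i : linear (antipode_coord i).
Proof. by move=> a x y; rewrite /antipode_coord !linearP !mxE. Qed.

HB.instance Definition _ i :=
  GRing.isLinear.Build R[i] G R[i]^o _ (antipode_coord i)
    (antipode_coord_is_linear i).

(** In Sweedler notation
[h 1 x = x_1 h (S x_2 x_3) = sum_i x_1 (S x_2)_i h (b_i x_3)] where [b] is the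
coordinate basis, and each term is the image of [x_1 h (b_i x_2)] under
[act (antipode_coord i)]. *)
Lemma act_separates h x :
  (forall c, act (mulf_left h c) x = 0) -> h 1 *: x = 0.
Proof.
move=> x0.
have antipode_law y :
    \sum_i conv (antipode_coord i) (mulf_left h (tbasis i)) y = h 1 * counit y.
  transitivity (h (tlift (fun a b : G => antipode a * b) (comult y))); last first.
    by rewrite antipodel linearZ mulrC.
  rewrite /conv; move: (comult y); apply: tlift_uniq => [c s t|c s t|u v].
  - by rewrite scaler_sumr -big_split; apply: eq_bigr => i _; rewrite linearP.
  - by rewrite !linearP.
  rewrite tlift_tens; first last.
  - by move=> u' c y' z; rewrite mulrDr scalerAr.
  - by move=> v' c y' z; rewrite linearP mulrDl scalerAl.
  rewrite [antipode u]tbasis_sum mulr_suml linear_sum; apply: eq_bigr => i _.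
  rewrite -/(tpair _ _ _) tpair_slice slice_tens -scalerAl !linearZ.
  by rewrite [LHS]mulrC.
have -> : h 1 *: x = \sum_i act (antipode_coord i) (act (mulf_left h (tbasis i)) x).
  rewrite -{1}[x]act_counit -sliceZ -(eq_slice antipode_law) slice_sum.
  by apply: eq_bigr => i _; rewrite actA.
by rewrite big1 // => i _; rewrite x0 linear0.
Qed.

End Convolution.

(** * The limit state and its support *)

Section Reducibility.
Context {R : realType} {G : finQuantumGroupType R}.
Implicit Types (f h nu : {scalar G}) (x y p u : G).

(** The limit of the Cesaro means of the convolution powers, realized as a fixed
combination of finitely many of them.  This makes the last property immediate
and deduces idempotence from invariance under [nu]. *)
Lemma invariant_state nu : positive nu -> nu 1 = 1 ->
  exists h : {scalar G}, [/\ positive h /\ h 1 = 1, conv nu h =1 h, conv h h =1 h &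
    forall x, (forall k, conv_pow nu k.+1 x = 0) -> h x = 0].
Proof.
move=> pnu nu1.
pose s k := conv_pow nu k.+1.
pose M : 'M[R[i]]_(dim G) := \matrix_(j, i) v2r (act nu (tbasis i)) 0 j.
pose v k : 'rV[R[i]]_(dim G) := \row_i s k (tbasis i).
have vM k : v 0%N *m M ^+ k = v k.
  elim: k => [|k IHk]; first by rewrite expr0 mulmx1.
  rewrite exprSr -mulmxE mulmxA IHk; apply/rowP=> i; rewrite !mxE.
  rewrite /s conv_powSr [act nu _]tbasis_sum linear_sum; apply: eq_bigr => j _.
  by rewrite !mxE linearZ mulrC.
have bdv : bounded_orbit M (v 0%N).
  (* one bound for all powers, at each basis vector *)
  have [D sD] := fin_all_exists (fun i => states_bounded (tbasis i : G)).
  have s_le k i : `|s k (tbasis i)| <= D i.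
    by have [pk k1] := conv_pow_state k pnu nu1; apply: (sD i (conv_pow nu k.+1)).
  exists (\sum_i D i) => k j; rewrite vM mxE (le_trans (s_le k j)) //.
  rewrite (bigD1 j) //= lerDl sumr_ge0 // => i _.
  exact: le_trans (s_le k i).
have [q q1 /= fixq] := mean_ergodic_combination bdv.
pose h0 x : R[i]^o := \sum_(i < size q) q`_i * s i x.
have h0_lin : linear h0.
  move=> a x y; rewrite scaler_sumr -big_split; apply: eq_bigr => i _.
  by rewrite /s linearP /= mulrDr scalerAr.
have [h hE] : exists h : {scalar G}, forall x, h x = \sum_(i < size q) q`_i * s i x.
  pose h : {scalar G} := HB.pack h0 (GRing.isLinear.Build R[i] G R[i]^o _ h0 h0_lin).
  by exists h.
(* the fixed vector of [M], read in coordinates: [M] is the matrix of [act nu] *)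
have h_nu x : h (act nu x) = h x.
  have wE j : h (tbasis j) = (\sum_(i < size q) q`_i *: (v 0%N *m M ^+ i)) 0 j.
    by rewrite hE summxE; apply: eq_bigr => i _; rewrite vM !mxE.
  rewrite [x]tbasis_sum [act nu _]linear_sum [LHS]linear_sum [RHS]linear_sum /=.
  apply: eq_bigr => j _; rewrite [act nu _]linearZ [LHS]linearZ [RHS]linearZ.
  congr (_ * _); rewrite wE -fixq mxE.
  rewrite [X in h X = _]tbasis_sum linear_sum; apply: eq_bigr => l _.
  by rewrite linearZ wE [M _ _]mxE mulrC.
have h_pow k x : \sum_(i < size q) q`_i * s (k + i)%N x = h x.
  elim: k x => [|k IHk] x; first by rewrite hE.
  rewrite -h_nu -IHk; apply: eq_bigr => i _.
  by rewrite /s addSn conv_powSr.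
have nu_h : conv nu h =1 h.
  move=> x; rewrite conv_act /act (eq_slice hE) slice_sum linear_sum -(h_pow 1%N).
  apply: eq_bigr => i _.
  by rewrite sliceZ linearZ /= -/(act (s i) x) -conv_act.
have pow_h k : conv (conv_pow nu k.+1) h =1 h.
  elim: k => [//|k IHk] x.
  transitivity (conv (conv nu (conv_pow nu k.+1)) h x); first by [].
  by rewrite -convA (eq_conv _ IHk) nu_h.
exists h; split=> //.
- split=> [x|].
    have [D xD] := states_bounded (star x * x).
    apply: (@cesaro_ge0 _ (fun k => s k (star x * x)) q D) => // k.
    have [pk k1] := conv_pow_state k pnu nu1.
    by rewrite pk -[X in X <= _]ger0_norm ?pk // xD.
  rewrite hE -[RHS]q1 horner_coef; apply: eq_bigr => i _.
  by have [_ k1] := conv_pow_state i pnu nu1; rewrite expr1n /s k1.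
- move=> x; rewrite conv_act hE.
  rewrite (eq_bigr (fun i : 'I__ => q`_i * h x)) => [|i _]; last first.
    by rewrite -(pow_h i) conv_act.
  rewrite -mulr_suml -[RHS]mul1r -q1 horner_coef; congr (_ * _).
  by apply: eq_bigr => i _; rewrite expr1n mulr1.
- by move=> x x0; rewrite hE big1 // => i _; rewrite /s x0 mulr0.
Qed.

Definition corner_functional f (u x : G) : R[i]^o := f (u * x * u).

Lemma corner_functional_is_linear f u : linear (corner_functional f u).
Proof.
by move=> a x y; rewrite /corner_functional mulrDr mulrDl -scalerAr -scalerAl linearP.
Qed.

HB.instance Definition _ f u :=
  GRing.isLinear.Build R[i] G R[i]^o _ (corner_functional f u)
    (corner_functional_is_linear f u).

Lemma corner_functional_positive f u :
  star u = u -> positive f -> positive (corner_functional f u).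
Proof.
move=> uu pf x; rewrite /= /corner_functional.
by rewrite mulrA -mulrA -{1}uu -starM.
Qed.

Lemma slice_mulf_left1 h (t : tensor G G) : slice (mulf_left h 1) t = slice h t.
Proof. by apply: eq_slice => x; rewrite /mulf_left mul1r. Qed.

(** If [(f (x) h) (comult (x^* x)) = 0], faithfulness of [f] gives the vanishing
required by [act_separates]. *)
Lemma conv_faithful f h : positive f -> (forall x, f (star x * x) = 0 -> x = 0) ->
  positive h -> h 1 = 1 -> forall x, conv f h (star x * x) = 0 -> x = 0.
Proof.
move=> pf faith ph h1 x; rewrite conv_tpair rmorphM /= comult_star => x0.
rewrite -[x]scale1r -h1; apply: act_separates => c.
exact: slice_null x0 c.
Qed.

(** The classical case is that a semigroup of a finite group carrying an
idempotent measure as its full support is a group.  Here faithfulness of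
[conv tau h], which rests on the antipode, plays the role of cancellation. *)
Lemma idempotent_support h p : positive h -> h 1 = 1 -> conv h h =1 h ->
    star p = p -> p * p = p -> (forall x, h (star x * x) = 0 <-> x * p = 0) ->
  act h p = p /\ comult p * tens 1 p = tens p p.
Proof.
move=> ph h1 hh ps pp supp.
have [u uE] : exists u, u = 1 - p by eexists.
have [us up uu] := complement_projection ps pp; rewrite -!uE in us up uu.
have hu : h u = 0 by rewrite -uu -{1}us; apply/supp.
have supp_null x : (forall y, h (y * x) = 0) -> x * p = 0.
  by move=> x0; apply/supp.
have [v vE] : exists v, v = act h u by eexists.
(* [(h (x) h) (comult u) = h u = 0], with [u = u^* u] *)
have vp : v * p = 0.
  apply: supp_null => a.
  rewrite vE /act -slice_mulf_left1 -slice_mull -tpair_slice.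
  apply: tpair_null => //.
  by rewrite -comult_star -rmorphM us uu -conv_tpair hh.
have vs : star v = v by rewrite vE -act_star // us.
have pv : p * v = 0 by rewrite -ps -vs -starM vp star0.
have uvu : u * v * u = v.
  by rewrite uE mulrBl mul1r pv subr0 mulrBr mulr1 vp subr0.
have Ep : act h p = 1 - v.
  have -> : p = 1 - u by rewrite uE opprB addrCA subrr addr0.
  by rewrite linearB /= act1 h1 scale1r -vE.
have [w defw] : exists w, w = u - v by eexists.
have wE : u * act h p * u = w by rewrite Ep mulrBr mulr1 mulrBl uu uvu defw.
have ws : star w = w by rewrite defw starD starN us vs.
have uw : u * w = w by rewrite -wE !mulrA uu.
have wu : w * u = w by rewrite -wE -!mulrA uu.
pose f : {scalar G} := conv (@regular_trace R G) h.
have pf : positive f by apply: conv_positive => //; apply: regular_trace_positive.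
have faith x : f (star x * x) = 0 -> x = 0.
  by apply: conv_faithful => //; [apply: regular_trace_positive | apply: regular_trace_faithful].
have w0 : w = 0.
  have fw : f w = 0.
    rewrite /f /= conv_act defw linearB /= vE actA.
    by rewrite (_ : act (conv h h) u = act h u) ?subrr ?linear0 //; apply: eq_slice.
  apply: faith; rewrite ws.
  (* the corner [f (u . u)] turns [w^2] into a functional of [w * act h p] *)
  have <- : corner_functional f u (w * act h p) = f (w * w).
    by rewrite /corner_functional mulrA uw -{1}wu -!mulrA [u * (_ * _)]mulrA wE.
  rewrite /act -slice_mulf_left1 -slice_mull -tpair_slice.
  apply: tpair_null => //; first exact: corner_functional_positive.
  by rewrite -comult_star -rmorphM ps pp tpair_slice /corner_functional /= -/(act h p) wE.
have {}Ep : act h p = p.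
  rewrite Ep; have <- : u = v by apply/eqP; rewrite -subr_eq0 -defw w0.
  by rewrite uE opprB addrCA subrr addr0.
split=> //.
pose z := comult p - tens p 1.
have zs : tstar z = z.
  rewrite /z -scaleN1r addrC tstar_conj_linear tstar_tens ps star1 -comult_star ps.
  by rewrite rmorphN rmorph1.
(* the slices of the four terms of [z^2] are all equal to [p], up to sign *)
have zz : slice h (z * z) = 0.
  rewrite /z mulrBr mulrBl -rmorphM pp mulrBl tens_mul pp mulr1 !linearB /=.
  rewrite slice_mull slice_mulf_left1 slice_mulr slice_tens -/(act h p) Ep h1 pp scale1r.
  by rewrite !subrr addr0.
have zp : z * tens 1 p = 0.
  apply: (slice_null_mulr supp_null) => c.
  apply: (slice_null regular_trace_positive ph (@regular_trace_faithful _ _)).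
  by rewrite zs tpair_slice zz linear0.
by move/eqP: zp; rewrite mulrBl tens_mul mulr1 mul1r subr_eq0 => /eqP.
Qed.

Lemma reducible_supported nu : state nu -> reducible nu ->
  exists S : quasi_subgroup G, proper_quasi_subgroup S /\ supported nu S.
Proof.
move=> [pnu nu1] [q [[qs qq] q0 nuq]].
have [h [[ph h1] nuh hh h0]] := invariant_state pnu nu1.
have [p [ps pp] supp] := support_projection ph.
have [Ep glp] := idempotent_support ph h1 hh ps pp supp.
have hp : h p = 1.
  have hu : h (star (1 - p) * (1 - p)) = 0.
    by have [_ up _] := complement_projection ps pp; apply/supp.
  have := positive_null ph hu 1; rewrite mul1r linearB /= h1 => /eqP.
  by rewrite subr_eq0 => /eqP.
have p0 : p <> 0 by move=> p0; move/eqP: hp; rewrite p0 linear0 eq_sym oner_eq0.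
have pglp : group_like_projection p by split.
exists (QuasiSubgroup pglp); split=> /= [p1|].
  apply: q0; rewrite -[q]mulr1 -p1; apply/supp; rewrite qs qq.
  by apply: h0 => k; apply: nuq.
by rewrite /supported /= -[in LHS]Ep -conv_act nuh.
Qed.

Lemma supported_reducible nu : state nu ->
  (exists S : quasi_subgroup G, proper_quasi_subgroup S /\ supported nu S) ->
  reducible nu.
Proof.
move=> [pnu nu1] [[p [[ps pp] p0 glp]] [/= p1 nup]].
rewrite /supported /= in nup p1.
pose u := 1 - p.
have [us _ uu] := complement_projection ps pp.
have nuu : nu u = 0 by rewrite linearB /= nu1 nup subrr.
have nu0 c : nu (c * u) = 0 by apply: positive_null; rewrite ?us ?uu.
have Ep : act nu p = p.
  (* [nu] vanishes on the left ideal generated by [1 - p] *)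
  have slice_p t : slice nu (t * tens 1 p) = slice nu t.
    move: t; apply: tlift_uniq => [c s t|c s t|a b].
    - by rewrite mulrDl -scalerAl !linearP.
    - by rewrite linearP.
    rewrite tens_mul !slice_tens mulr1; congr (_ *: _); apply/eqP.
    by rewrite eq_sym -subr_eq0 -linearB /= -{1}[b]mulr1 -mulrBr nu0.
  by rewrite /act -slice_p glp slice_tens nup scale1r.
exists u; split=> // [u0|[//|k] _].
  by apply: p1; apply/eqP; rewrite eq_sym -subr_eq0 -/u u0.
have [pk k1] := conv_pow_state k pnu nu1.
rewrite linearB /= k1.
suff -> : conv_pow nu k.+1 p = 1 by rewrite subrr.
by elim: k {pk k1} => [//|k IHk]; rewrite conv_powSr Ep.
Qed.

End Reducibility.

Theorem theorem3p13 (R : realType) (G : finQuantumGroupType R)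
    (nu : {scalar G}) (hnu : state nu) :
  irreducible nu <->
  ~ (exists S : quasi_subgroup G, proper_quasi_subgroup S /\ supported nu S).
Proof.
split=> [irr | noS red].
  by move=> /(supported_reducible hnu).
by apply: noS; apply: reducible_supported.
Qed.
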